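(* Let $(W,S,L)$ be any positively weighted Coxeter group of finite rank. Then there exists a constant $N'_L(W)\in\mathbb{N}$ such that $N'_L(W)$ is a bound for $(W,S,L)$; that is, $v^{-N'_L(W)} f_{x,y,z}\in\mathbb{Z}[v^{-1}]$ for all $x,y,z\in W$.
   Context: A positively weighted Coxeter group of finite rank is a triple $(W,S,L)$ where $(W,S)$ is a Coxeter group with $S$ finite and length function $\ell:W\to\mathbb{N}$, and $L:W\to\mathbb{N}$ is a function such that $L(s)>0$ for all $s\in S$ and $L(ww')=L(w)+L(w')$ for all $w,w'\in W$ with $\ell(ww')=\ell(w)+\ell(w')$. Let $v$ be an indeterminate and $\mathcal{A}=\mathbb{Z}[v^{\pm1}]$. The associated Hecke algebra $\mathcal{H}$ is the free $\mathcal{A}$-module with basis $\{T_w\mid w\in W\}$ and with multiplication determined by $T_wT_{w'}=T_{ww'}$ if $\ell(ww')=\ell(w)+\ell(w')$, and $T_s^2=(v^{L(s)}-v^{-L(s)})T_s+T_e$ for $s\in S$, where $e$ is the neutral element of $W$. The structure constants $f_{x,y,z}\in\mathcal{A}$ are defined by $T_xT_y=\sum_{z\in W}f_{x,y,z}T_z$ for $x,y\in W$. A number $N\in\mathbb{N}$ is called a bound for $(W,S,L)$ if $v^{-N}f_{x,y,z}\in\mathbb{Z}[v^{-1}]$ for all $x,y,z\in W$. *)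

(* Defs.v *)
From HB Require Import structures.
From mathcomp Require Import all_boot all_order all_algebra finmap boolp.

Set Implicit Arguments.
Unset Strict Implicit.
Unset Printing Implicit Defensive.

Import GRing.Theory.

Local Open Scope ring_scope.
Local Notation "x %:F" := (tofrac x).

(* Z[v, v^-1], as the subring of Z(v) of the fractions whose denominator is a
   power of v.  *)
Definition laurent_pred : {pred {fraction {poly int}}} :=
  fun f => `[< exists (p : {poly int}) (n : nat), f = p%:F / ('X%:F) ^+ n >].

Lemma Xfrac_neq0 : ('X : {poly int})%:F != 0.
Proof. by rewrite tofrac_eq0 polyX_eq0. Qed.

Lemma laurent_pred_subring : subring_closed laurent_pred.
Proof.
have Xn n : (('X : {poly int})%:F) ^+ n != 0 by rewrite expf_neq0 ?Xfrac_neq0.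
split; first by apply/asboolP; exists 1, 0%N; rewrite expr0 divr1 tofrac1.
- move=> _ _ /asboolP[p [n ->]] /asboolP[q [k ->]]; apply/asboolP.
  exists (p * 'X^k - q * 'X^n), (n + k)%N.
  rewrite -mulNr addf_div ?Xn // mulNr exprD.
  by rewrite !tofracB !tofracM !tofracXn.
- move=> _ _ /asboolP[p [n ->]] /asboolP[q [k ->]]; apply/asboolP.
  by exists (p * q), (n + k)%N; rewrite mulf_div exprD tofracM.
Qed.

HB.instance Definition _ :=
  GRing.isSubringClosed.Build _ laurent_pred laurent_pred_subring.

Record laurent := Laurent {
  laurent_val :> {fraction {poly int}};
  laurentP : laurent_val \in laurent_pred }.

HB.instance Definition _ := [isSub for laurent_val].
HB.instance Definition _ := [Choice of laurent by <:].
HB.instance Definition _ := [SubChoice_isSubComNzRing of laurent by <:].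

Lemma vvar_subproof : 'X%:F \in laurent_pred.
Proof. by apply/asboolP; exists 'X, 0%N; rewrite expr0 divr1. Qed.

Lemma vinv_subproof : ('X%:F)^-1 \in laurent_pred.
Proof. by apply/asboolP; exists 1, 1%N; rewrite expr1 tofrac1 div1r. Qed.

Definition vvar : laurent := Laurent vvar_subproof.
Definition vinv : laurent := Laurent vinv_subproof.

Lemma vvarK : vvar * vinv = 1.
Proof. by apply: val_inj; rewrite /= divff ?Xfrac_neq0. Qed.

Definition in_Zvinv (f : laurent) : Prop :=
  exists p : {poly int}, f = (map_poly intr p).[vinv].

Section Coxeter.
Variables (W : groupType) (S : {fset W}).

(* The value 0 of a Coxeter matrix encodes infinity: the relation
   (st)^0 = 1 below is then void. *)
Definition coxeter_matrix (m : S -> S -> nat) : Prop :=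
  forall s t : S, m s t = m t s /\ (m s t = 1%N <-> s = t).

Definition word_of_length (n : nat) (w : W) : bool :=
  [exists t : n.-tuple S, w == (\prod_(s <- t) val s)%g].

(* W is the group with generators S and relations (st)^(m s t) = 1.  As these
   generators are involutions, they generate W as a monoid. *)
Definition presented_by (m : S -> S -> nat) : Prop :=
  [/\ forall w : W, exists n : nat, word_of_length n w,
      forall s t : S, ((val s * val t) ^+ m s t = 1)%g
    & forall (G : groupType) (phi : S -> G),
        (forall s t : S, ((phi s * phi t) ^+ m s t = 1)%g) ->
        exists g : W -> G,
          {morph g : x y / (x * y)%g} /\ (forall s : S, g (val s) = phi s)].

Definition coxeter_system : Prop :=
  exists2 m : S -> S -> nat, coxeter_matrix m & presented_by m.

(* The default value 0 is only taken on elements that are not products of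
   elements of S. *)
Definition coxeter_length (w : W) : nat :=
  if pselect (exists n : nat, word_of_length n w) is left ex
  then ex_minn ex else 0%N.

Local Notation ell := coxeter_length.

Definition positive_weight (L : W -> nat) : Prop :=
  (forall s : S, (0 < L (val s))%N) /\
  (forall w w' : W, ell (w * w')%g = (ell w + ell w')%N ->
     L (w * w')%g = (L w + L w')%N).

Definition positively_weighted_coxeter (L : W -> nat) : Prop :=
  coxeter_system /\ positive_weight L.

Definition is_lincomb (H : lmodType laurent) (T : W -> H)
    (c : {fsfun W -> laurent with 0}) (h : H) : Prop :=
  h = \sum_(w <- finsupp c) c w *: T w.

Definition free_basis (H : lmodType laurent) (T : W -> H) : Prop :=
  forall h : H, exists! c : {fsfun W -> laurent with 0}, is_lincomb T c h.

Record hecke_algebra (L : W -> nat) (H : algType laurent) (T : W -> H) : Prop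
  := HeckeAlgebra {
  hecke_basis : free_basis T;
  hecke_mul : forall w w' : W, ell (w * w')%g = (ell w + ell w')%N ->
    T w * T w' = T (w * w')%g;
  hecke_quad : forall s : S,
    T (val s) * T (val s) =
      (vvar ^+ L (val s) - vinv ^+ L (val s)) *: T (val s) + T 1%g }.

Definition structure_constants (H : algType laurent) (T : W -> H)
    (f : W -> W -> {fsfun W -> laurent with 0}) : Prop :=
  forall x y : W, is_lincomb T (f x y) (T x * T y).

(* The Hecke algebra with its basis is unique up to a unique isomorphism;
   quantifying over all its models makes N depend on (W, S, L) only. *)
Definition is_bound (L : W -> nat) (N : nat) : Prop :=
  forall (H : algType laurent) (T : W -> H)
         (f : W -> W -> {fsfun W -> laurent with 0}),
    hecke_algebra L T -> structure_constants T f ->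
    forall x y z : W, in_Zvinv (vinv ^+ N * f x y z).

End Coxeter.

(* Main.v *)
(* Let [W] act on the span of its simple roots.  Call two roots crossing when
   all four sign patterns of [(w b, w c)], for [w] in [W], occur.

   Expanding [T_w T_u] along a reduced word of [u], a factor
   [v^(L s) - v^-(L s)] appears whenever a letter [s] is folded, so it suffices
   to bound the number of folds uniformly.  If [n] folds occur, there are [n]
   pairwise crossing roots whose hyperplanes separate [w] both from [1] and from
   [w u]: reading the word backwards, the steps without fold transport such a
   family by [s], and at a fold some of its members can be replaced by their
   images under [s] so that the simple root of [s] may be added.

   The size of a family of pairwise crossing roots is bounded: two crossing
   roots are conjugate into a finite standard parabolic subsystem, so that the
   form takes finitely many values, different from [1], on crossing pairs, and a
   Gram matrix of rank at most [|S|] with unit diagonal, entries in a finite set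
   and no [1] off the diagonal has bounded size. *)
Require Import Defs.
From mathcomp Require Import Rstruct.
From HB Require Import structures.
From mathcomp Require Import all_boot all_order all_algebra finmap.
From mathcomp Require Import boolp reals trigo.
From mathcomp Require Import ring lra zify.

Set Implicit Arguments.
Unset Strict Implicit.
Unset Printing Implicit Defensive.

Import Order.TTheory GRing.Theory Num.Theory.

Local Open Scope ring_scope.

(** * Permutation groups *)

Section Bijections.
Variable X : Type.

(** The universal property of [W] needs a target group. The permutations of a possibly infinite type
    form one; storing the inverse makes inversion definable. *)
Record bijection := Bijection {
  bij_fun :> X -> X;
  bij_inv : X -> X;
  bij_funK : cancel bij_fun bij_inv;
  bij_invK : cancel bij_inv bij_fun }.

Lemma bijection_ext (f g : bijection) : bij_fun f =1 bij_fun g -> f = g.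
Proof.
case: f g => [f f' fK f'K] [g g' gK g'K] /= /funext efg.
subst g; have e : f' = g' by apply/funext => x; rewrite -[in RHS](f'K x) gK.
by subst g'; congr Bijection; exact: Prop_irrelevance.
Qed.

Definition bij_id := @Bijection id id (fun=> erefl) (fun=> erefl).

Definition bij_comp (f g : bijection) : bijection :=
  Bijection (can_comp (bij_funK f) (bij_funK g))
            (can_comp (bij_invK g) (bij_invK f)).

Definition bij_sym (f : bijection) : bijection :=
  Bijection (bij_invK f) (bij_funK f).

HB.instance Definition _ := gen_eqMixin bijection.
HB.instance Definition _ := gen_choiceMixin bijection.

Lemma bij_compA : associative bij_comp.
Proof. by move=> f g h; apply: bijection_ext. Qed.
Lemma bij_comp1g : left_id bij_id bij_comp.
Proof. by move=> f; apply: bijection_ext. Qed.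
Lemma bij_compg1 : right_id bij_id bij_comp.
Proof. by move=> f; apply: bijection_ext. Qed.
Lemma bij_compVg : left_inverse bij_id bij_sym bij_comp.
Proof. by move=> f; apply: bijection_ext => x /=; rewrite bij_funK. Qed.
Lemma bij_compgV : right_inverse bij_id bij_sym bij_comp.
Proof. by move=> f; apply: bijection_ext => x /=; rewrite bij_invK. Qed.

HB.instance Definition _ := isGroup.Build bijection
  bij_compA bij_comp1g bij_compg1 bij_compVg bij_compgV.

Lemma bij_mulE (f g : bijection) x : (f * g)%g x = f (g x).
Proof. by []. Qed.

Lemma bij_expE (f : bijection) n x : (f ^+ n)%g x = iter n f x.
Proof. by elim: n x => [|n IHn] x //; rewrite expgS bij_mulE IHn. Qed.

End Bijections.

(** * The geometric representation *)

Section Geometry.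
Variables (R : realType) (I : finType) (m : I -> I -> nat).
Local Notation V := {ffun I -> R^o}.

(** The value [m s t = 0] stands for infinity, and [-1] is the limit of [- cos (pi / m)]. *)
Definition cox_coef (s t : I) : R :=
  if m s t == 0%N then -1 else - cos (pi / (m s t)%:R).

Definition bform (x y : V) : R := \sum_s \sum_t x s * y t * cox_coef s t.

Definition simple_root (s : I) : V := [ffun t => (t == s)%:R].

Definition reflection (b x : V) : V := x - (2 * bform x b) *: b.

Hypothesis m_sym : forall s t, m s t = m t s.
Hypothesis m_diag : forall s t, m s t = 1%N <-> s = t.

Lemma bformC x y : bform x y = bform y x.
Proof.
rewrite /bform exchange_big /=; apply: eq_bigr => s _; apply: eq_bigr => t _.
by rewrite /cox_coef m_sym [x t * _]mulrC.
Qed.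

Lemma bformDl x y z : bform (x + y) z = bform x z + bform y z.
Proof.
rewrite /bform -big_split /=; apply: eq_bigr => s _.
rewrite -big_split /=; apply: eq_bigr => t _; rewrite ffunE.
by rewrite !mulrDl.
Qed.

Lemma bformZl c x z : bform (c *: x) z = c * bform x z.
Proof.
rewrite /bform mulr_sumr; apply: eq_bigr => s _.
rewrite mulr_sumr; apply: eq_bigr => t _; rewrite ffunE /= !mulrA.
by [].
Qed.

Lemma bformNl x z : bform (- x) z = - bform x z.
Proof. by rewrite -scaleN1r bformZl mulN1r. Qed.

Lemma bformBl x y z : bform (x - y) z = bform x z - bform y z.
Proof. by rewrite bformDl bformNl. Qed.

Lemma bformDr x y z : bform z (x + y) = bform z x + bform z y.
Proof. by rewrite !(bformC z) bformDl. Qed.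

Lemma bformZr c x z : bform z (c *: x) = c * bform z x.
Proof. by rewrite !(bformC z) bformZl. Qed.

Lemma bformNr x z : bform z (- x) = - bform z x.
Proof. by rewrite !(bformC z) bformNl. Qed.

Lemma bformBr x y z : bform z (x - y) = bform z x - bform z y.
Proof. by rewrite bformDr bformNr. Qed.

Definition bformE :=
  (bformDl, bformDr, bformBl, bformBr, bformNl, bformNr, bformZl, bformZr).

Lemma bform_simple s t : bform (simple_root s) (simple_root t) = cox_coef s t.
Proof.
rewrite /bform (bigD1 s) //= (bigD1 t) //= !ffunE !eqxx !mul1r.
rewrite big1 => [|j /negPf nj]; last by rewrite !ffunE nj mulr0 mul0r.
rewrite addr0 big1 ?addr0 // => i /negPf ni; apply: big1 => j _.
by rewrite !ffunE ni !mul0r.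
Qed.

Lemma cox_coef_diag s : cox_coef s s = 1.
Proof.
have /eqP := (proj2 (m_diag s s) erefl).
by rewrite /cox_coef => /eqP ->; rewrite /= divr1 cospi opprK.
Qed.

Lemma bform_simple1 s : bform (simple_root s) (simple_root s) = 1.
Proof. by rewrite bform_simple cox_coef_diag. Qed.

Lemma reflectionD b x y :
  reflection b (x + y) = reflection b x + reflection b y.
Proof. by rewrite /reflection bformDl mulrDr scalerDl opprD addrACA. Qed.

Lemma reflectionZ b c x : reflection b (c *: x) = c *: reflection b x.
Proof. by rewrite /reflection bformZl scalerBr scalerA mulrCA. Qed.

Lemma reflection_isom b x y : bform b b = 1 ->
  bform (reflection b x) (reflection b y) = bform x y.
Proof.
by move=> b1; rewrite /reflection !bformE b1 (bformC b y) ; ring.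
Qed.

Lemma reflectionK b : bform b b = 1 -> involutive (reflection b).
Proof.
move=> b1 x; rewrite /reflection !bformE b1; set k := bform x b.
rewrite -addrA -opprD -scalerDl.
rewrite (_ : 2 * k + 2 * (k - 2 * k * 1) = 0); last ring.
by rewrite scale0r subr0.
Qed.

Lemma reflection_self b : bform b b = 1 -> reflection b b = - b.
Proof.
move=> b1; rewrite /reflection b1 mulr1 scaler_nat mulr2n opprD addrA.
by rewrite subrr sub0r.
Qed.

Lemma reflection_fix b x : bform x b = 0 -> reflection b x = x.
Proof. by move=> xb; rewrite /reflection xb mulr0 scale0r subr0. Qed.

(** * Chebyshev polynomials and the dihedral relations *)

(** Chebyshev polynomials of the second kind with shifted index: [cheb c n] is [U_{n-1}(c)]. They
    are the coordinates along the orbits of a dihedral group. *)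
Fixpoint cheb (c : R) (n : nat) : R :=
  if n is n1.+1 then
    if n1 is n2.+1 then 2 * c * cheb c n1 - cheb c n2 else 1
  else 0.

Lemma chebSS c n : cheb c n.+2 = 2 * c * cheb c n.+1 - cheb c n.
Proof. by []. Qed.

Lemma cheb_sin th n : sin th * cheb (cos th) n = sin (n%:R * th).
Proof.
suff: sin th * cheb (cos th) n = sin (n%:R * th) /\
      sin th * cheb (cos th) n.+1 = sin (n.+1%:R * th) by case.
elim: n => [|n [IHn IHn1]].
  by rewrite /= mulr0 mul0r sin0 mulr1 mul1r.
split=> //; rewrite chebSS mulrBr IHn mulrCA IHn1.
have -> : n.+2%:R * th = n.+1%:R * th + th by rewrite -[n.+2]addn1 natrD; ring.
have -> : n%:R * th = n.+1%:R * th - th by rewrite -[n.+1]addn1 natrD; ring.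
rewrite sinB sinD; ring.
Qed.

Lemma cheb1 n : cheb 1 n = n%:R.
Proof.
suff: cheb 1 n = n%:R /\ cheb 1 n.+1 = n.+1%:R by case.
elim: n => [|n [IHn IHn1]] //; split=> //.
by rewrite chebSS IHn1 IHn -addn2 -[n.+1]addn1 !natrD; ring.
Qed.

Section Dihedral.
Variables s t : I.
Hypothesis neq_st : s != t.
Local Notation c := (- cox_coef s t).

Lemma angle_bounds : m s t != 0%N ->
  0 < (pi / (m s t)%:R : R) < pi /\ c = cos (pi / (m s t)%:R) :> R.
Proof.
move=> m0; rewrite /cox_coef (negPf m0) opprK; split=> //.
have m1 : (1 < m s t)%N.
  rewrite ltn_neqAle eq_sym lt0n m0 andbT; apply: contra neq_st => /eqP.
  by move/(proj1 (m_diag s t))/eqP.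
have mp : 0 < (m s t)%:R :> R by rewrite ltr0n lt0n.
by rewrite divr_gt0 ?pi_gt0 //= ltr_pdivrMr // ltr_pMr ?pi_gt0 // ltr1n.
Qed.

(** The value is [sin (k pi / m) / sin (pi / m)] for finite [m], and [k] for infinite [m], where
    [c = 1]. *)
Lemma cheb_ge0 k : m s t = 0%N \/ (k <= m s t)%N -> 0 <= cheb c k.
Proof.
have [m0 _|m0 [/eqP|km]] := eqVneq (m s t) 0%N; last 2 first.
- by rewrite (negPf m0).
- have [/andP[th0 thpi] ->] := angle_bounds m0.
  set th := pi / _ in th0 thpi *.
  have sth : 0 < sin th by rewrite sin_gt0_pi // th0.
  rewrite -(pmulr_rge0 _ sth) cheb_sin sin_ge0_pi //.
  rewrite mulr_ge0 ?(ltW th0) //= mulrC -mulrA ler_piMr ?pi_ge0 //.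
  by rewrite mulrC ler_pdivrMr ?mul1r ?ler_nat // ltr0n lt0n.
by rewrite /cox_coef m0 eqxx opprK cheb1.
Qed.

Lemma reflection_step p q :
  reflection (simple_root t) (p *: simple_root s + q *: simple_root t) =
  p *: simple_root s + (2 * c * p - q) *: simple_root t.
Proof.
rewrite /reflection !bformE bform_simple1 bform_simple -addrA -scalerBl.
by congr (_ + _ *: _); ring.
Qed.

End Dihedral.

Lemma cox_coef_sym s t : cox_coef s t = cox_coef t s.
Proof. by rewrite /cox_coef m_sym. Qed.

Lemma iter_reflections s t k :
  let c := - cox_coef s t in
  iter k (reflection (simple_root s) \o reflection (simple_root t))
    (simple_root s) =
  cheb c k.*2.+1 *: simple_root s + cheb c k.*2 *: simple_root t.
Proof.
move=> c; elim: k => [|k IHk]; first by rewrite /= scale1r scale0r addr0.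
rewrite iterS {}IHk doubleS [LHS]/= reflection_step addrC reflection_step addrC.
by rewrite (cox_coef_sym t s) -/c -!chebSS.
Qed.

(** With [th = pi / m], the coefficients after [m] rounds are [sin (2 pi + th) / sin th = 1] and
    [sin (2 pi) / sin th = 0]. *)
Lemma braid_fix s t : s != t -> m s t != 0%N ->
  iter (m s t) (reflection (simple_root s) \o reflection (simple_root t))
    (simple_root s) = simple_root s.
Proof.
move=> st m0; rewrite iter_reflections.
have [/andP[th0 thpi] ->] := angle_bounds st m0.
set th := pi / _ in th0 thpi *.
have sth : sin th != 0 by rewrite gt_eqF // sin_gt0_pi // th0.
have mth : (m s t).*2%:R * th = pi *+ 2.
  by rewrite -muln2 natrM /th mulr2n; field; rewrite pnatr_eq0.
have -> : cheb (cos th) (m s t).*2 = 0.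
  by apply: (mulfI sth); rewrite cheb_sin mth sin2pi mulr0.
have -> : cheb (cos th) (m s t).*2.+1 = 1.
  apply: (mulfI sth); rewrite cheb_sin -addn1 natrD mulrDl mth mul1r mulr1.
  by rewrite addrC sinD2pi.
by rewrite scale1r scale0r addr0.
Qed.

Lemma braid_relation s t x :
  iter (m s t) (reflection (simple_root s) \o reflection (simple_root t)) x
  = x.
Proof.
have [<-|st] := eqVneq s t.
  by rewrite (proj2 (m_diag s s) erefl) /= reflectionK // bform_simple1.
have [->//|m0] := eqVneq (m s t) 0%N.
set a := simple_root s; set b := simple_root t.
set f := reflection a \o reflection b.
have fD n y z : iter n f (y + z) = iter n f y + iter n f z.
  by elim: n => //= n ->; rewrite /f /= !reflectionD.
have fZ n k y : iter n f (k *: y) = k *: iter n f y.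
  by elim: n => //= n ->; rewrite /f /= !reflectionZ.
have fa : iter (m s t) f a = a by exact: braid_fix.
have fb : iter (m s t) f b = b.
  have fK n y : iter n f (iter n (reflection b \o reflection a) y) = y.
    elim: n y => // n IHn y; rewrite iterSr [X in f X]/= /f /=.
    by rewrite !reflectionK ?bform_simple1 // IHn.
  have e : iter (m s t) (reflection b \o reflection a) b = b.
    by rewrite m_sym; apply: braid_fix; [rewrite eq_sym | rewrite m_sym].
  by rewrite -[X in iter _ f X = _]e fK.
have [/andP[th0 thpi] cE] := angle_bounds st m0.
set c := - cox_coef s t in cE.
have c1 : 1 - c ^+ 2 != 0.
  by rewrite cE -sin2cos2 expf_neq0 // gt_eqF // sin_gt0_pi // th0.
(* [p] and [q] solve the Gram system of the plane, of determinant [1 - c^2], so that [x - y] is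
   orthogonal to both roots and fixed by both reflections. *)
pose p := (bform x a + c * bform x b) / (1 - c ^+ 2).
pose q := (bform x b + c * bform x a) / (1 - c ^+ 2).
pose y := p *: a + q *: b.
have ab : bform a b = - c by rewrite bform_simple opprK.
have xya : bform (x - y) a = 0.
  rewrite !bformE (bformC b) ab bform_simple1 /p /q; field; exact: c1.
have xyb : bform (x - y) b = 0.
  rewrite !bformE ab bform_simple1 /p /q; field; exact: c1.
have fxy : iter (m s t) f (x - y) = x - y.
  by elim: (m s t) => //= n ->; rewrite /f /= !reflection_fix.
by rewrite -[x](subrK y) fD fxy fD !fZ fa fb.
Qed.

Lemma simple_reflection_subproof s :
  cancel (reflection (simple_root s)) (reflection (simple_root s)).
Proof. by apply: reflectionK; exact: bform_simple1. Qed.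

Definition simple_reflection s : bijection V :=
  Bijection (simple_reflection_subproof s) (simple_reflection_subproof s).

Lemma simple_reflection_braid s t :
  ((simple_reflection s * simple_reflection t) ^+ m s t = 1)%g.
Proof.
by apply: bijection_ext => x; rewrite bij_expE; exact: braid_relation.
Qed.

End Geometry.

(** * The length function *)

Section CoxeterLength.
Variables (W : groupType) (S : {fset W}) (m : S -> S -> nat).
Hypotheses (mP : coxeter_matrix m) (presW : presented_by m).
Local Notation ell := (coxeter_length S).
Implicit Types (s t a b : S) (w v : W).

Definition word_prod (t : seq S) : W := (\prod_(s <- t) val s)%g.

Lemma word_of_lengthP n w :
  reflect (exists2 t : seq S, size t = n & w = word_prod t)
          (word_of_length S n w).
Proof.
apply: (iffP existsP) => [[t /eqP ->]|[t <- ->]].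
  by exists t; rewrite ?size_tuple.
by exists (in_tuple t); rewrite eqxx.
Qed.

Lemma reduced_word w : exists2 t, size t = ell w & w = word_prod t.
Proof.
have [ex _ _] := presW; apply/word_of_lengthP; rewrite /coxeter_length.
by case: pselect => [e|/(_ (ex w))//]; case: ex_minnP.
Qed.

Lemma length_word_prod (t : seq S) : (ell (word_prod t) <= size t)%N.
Proof.
have wt : word_of_length S (size t) (word_prod t).
  by apply/word_of_lengthP; exists t.
rewrite /coxeter_length; case: pselect => [e|//].
by case: ex_minnP => n _ /(_ _ wt).
Qed.

Lemma word_prod_cat (s t : seq S) :
  word_prod (s ++ t) = (word_prod s * word_prod t)%g.
Proof. by rewrite /word_prod big_cat. Qed.

Lemma word_prod1 s : word_prod [:: s] = val s.
Proof. by rewrite /word_prod big_seq1. Qed.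

Lemma length1 : ell 1%g = 0%N.
Proof.
apply/eqP; rewrite -leqn0; have := length_word_prod [::].
by rewrite /word_prod big_nil.
Qed.

Lemma lengthM w w' : (ell (w * w')%g <= ell w + ell w')%N.
Proof.
have [t <- {1}->] := reduced_word w; have [t' <- {1}->] := reduced_word w'.
by rewrite -word_prod_cat -size_cat length_word_prod.
Qed.

Lemma genK s : (val s * val s = 1 :> W)%g.
Proof.
have [_ rel _] := presW; have := rel s s.
by rewrite (proj2 (proj2 (mP s s)) erefl) expg1.
Qed.

Lemma genV s : ((val s)^-1 = val s :> W)%g.
Proof. exact/mulg1_eq/genK. Qed.

Lemma mulg_genK (w : W) s : (w * val s * val s)%g = w.
Proof. by rewrite -mulgA genK mulg1. Qed.

Lemma gen_mulgK (w : W) s : (val s * (val s * w))%g = w.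
Proof. by rewrite mulgA genK mul1g. Qed.

Lemma length_inv w : ell (w^-1)%g = ell w.
Proof.
have le_inv x : (ell (x^-1)%g <= ell x)%N.
  have [t <- {1}->] := reduced_word x; rewrite -size_rev.
  suff -> : ((word_prod t)^-1)%g = word_prod (rev t) by exact: length_word_prod.
  elim: t => [|s t IHt]; first by rewrite /word_prod big_nil invg1.
  rewrite rev_cons -cats1 -cat1s !word_prod_cat invgM IHt word_prod1.
  by rewrite genV.
by apply/eqP; rewrite eqn_leq le_inv -{1}[w]invgK le_inv.
Qed.

Lemma length_gen_le s : (ell (val s) <= 1)%N.
Proof. by rewrite -word_prod1 length_word_prod. Qed.

(* The sign character is obtained from the universal property applied to the
   permutations of a two-element set. *)
Lemma odd_length_gen w s : odd (ell (w * val s)%g) = ~~ odd (ell w).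
Proof.
have [_ _ univ] := presW.
pose neg := Bijection negbK negbK.
have [|g [gM gs]] := univ _ (fun=> neg).
  move=> s1 t1; apply: bijection_ext => x; rewrite bij_expE.
  by elim: (m s1 t1) => //= n ->; rewrite negbK.
have g1 : g 1%g = 1%g.
  by apply: (mulgI (g 1%g)); rewrite -gM !mulg1.
have gE x : g x true = ~~ odd (ell x).
  have [t <- ->] := reduced_word x; elim: t => [|u t IHt].
    by rewrite /word_prod big_nil g1.
  by rewrite -cat1s word_prod_cat gM bij_mulE IHt word_prod1 gs.
have gN x : g x false = odd (ell x).
  have [t <- ->] := reduced_word x; elim: t => [|u t IHt].
    by rewrite /word_prod big_nil g1.
  by rewrite -cat1s word_prod_cat gM bij_mulE IHt word_prod1 gs.
by apply: negb_inj; rewrite -gE gM bij_mulE gs /= gN negbK.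
Qed.

Lemma length_mul_gen w s :
  ell (w * val s)%g = (ell w).+1 \/ ell w = (ell (w * val s)%g).+1.
Proof.
have le1 x : (ell (x * val s)%g <= (ell x).+1)%N.
  by rewrite -addn1 (leq_trans (lengthM _ _)) // leq_add2l length_gen_le.
have := le1 (w * val s)%g; have := le1 w; rewrite mulg_genK.
have := odd_length_gen w s.
case: (ltngtP (ell (w * val s)%g) (ell w)) => [lt|gt|->]; last by case: odd.
- by move=> _ _ le; right; apply/eqP; rewrite eqn_leq le.
- by move=> _ le _; left; apply/eqP; rewrite eqn_leq le.
Qed.

Lemma right_descent w : w != 1%g ->
  exists s, ell w = (ell (w * val s)%g).+1.
Proof.
have [t tw wE] := reduced_word w.
case/lastP: t => [|t s] in tw wE *; first by rewrite wE /word_prod big_nil eqxx.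
exists s; have wtE : (w * val s)%g = word_prod t.
  by rewrite wE -cats1 word_prod_cat word_prod1 mulg_genK.
case: (length_mul_gen w s) => // le.
have := length_word_prod t; rewrite -wtE le -tw size_rcons; lia.
Qed.

Lemma left_descent w : w != 1%g ->
  exists s, ell w = (ell (val s * w)%g).+1.
Proof.
move=> w1; have [|s ls] := @right_descent (w^-1)%g.
  by rewrite invg_eq1.
exists s; rewrite -(length_inv w) ls -(length_inv (val s * w)%g) invgM genV.
by [].
Qed.

(* The alternating product [... b a b a] with [k] factors, ending in [a]. *)
Fixpoint altprod (a b : S) (k : nat) : W :=
  (if k is k1.+1 then val (if odd k1 then b else a) * altprod a b k1
   else 1)%g.

Lemma altprodS a b k :
  altprod a b k.+1 = (val (if odd k then b else a) * altprod a b k)%g.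
Proof. by []. Qed.

Lemma length_altprod a b k : (ell (altprod a b k) <= k)%N.
Proof.
elim: k => [|k IHk]; first by rewrite /= length1.
by rewrite (leq_trans (lengthM _ _)) // -add1n leq_add // length_gen_le.
Qed.

Lemma altprod_div s t k :
  (altprod t s k * (altprod s t k)^-1 =
   if odd k then (val t * val s) ^+ k else (val s * val t) ^+ k)%g.
Proof.
elim: k => [|k IHk]; first by rewrite /= expg0 mul1g invg1.
have exC (x y : W) n : (x * (y * x) ^+ n * y = (x * y) ^+ n.+1)%g.
  elim: n => [|n IHn]; first by rewrite expg0 mulg1 expg1.
  by rewrite expgSr !mulgA IHn -[(_ * x * y)%g]mulgA -expgSr.
rewrite /= invgM -!mulgA [X in (_ * X)%g]mulgA {}IHk genV.
by case: (odd k) => /=; rewrite mulgA exC.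
Qed.

Lemma altprod_braid s t : altprod t s (m s t) = altprod s t (m s t).
Proof.
have [_ rel _] := presW; have := altprod_div s t (m s t).
have -> : ((val t * val s) ^+ m s t = 1)%g by rewrite (mP s t).1 rel.
by rewrite rel if_same => /divg1_eq.
Qed.

Lemma altprod_split s t j k : exists2 x,
  (ell x <= j)%N & altprod t s (j + k) = (x * altprod t s k)%g.
Proof.
elim: j => [|j [x lx IHj]]; first by exists 1%g; rewrite ?length1 ?mul1g.
exists (val (if odd (j + k) then s else t) * x)%g; last first.
  by rewrite /= IHj mulgA.
by rewrite (leq_trans (lengthM _ _)) // -add1n leq_add // length_gen_le.
Qed.

(** The last [m s t] letters form one side of the braid relation and can be rewritten to end in [s],
    which then cancels. *)
Lemma length_altprod_braid s t k : m s t != 0%N -> (m s t <= k)%N ->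
  (ell (altprod t s k * val s)%g < k)%N.
Proof.
move=> m0 mk; have [x] := altprod_split s t (k - m s t) (m s t).
rewrite subnK // => lx ->; rewrite altprod_braid -mulgA.
apply: leq_ltn_trans (lengthM _ _) _.
have alt_last n : (altprod s t n.+1 * val s)%g = altprod t s n.
  elim: n => [|n IHn]; first by rewrite /= mulg1 genK.
  rewrite [altprod s t _]/= -/(altprod s t n.+1) -mulgA IHn /=.
  by case: (odd n).
case: (m s t) (length_altprod t s (m s t).-1) m0 mk lx => //= n le _ mk lx.
rewrite -/(altprod s t n.+1) alt_last; lia.
Qed.

(* Stripping letters [a], [b], [a], ... from the right as long as the length
   drops reaches the minimal element of the coset [w <a, b>]. *)
Lemma strip_altprod w a b : exists v k,
  [/\ w = (v * altprod a b k)%g, ell w = (ell v + k)%N &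
      ell (v * val (if odd k then b else a))%g = (ell v).+1].
Proof.
suff strip n v k : ell v = n -> w = (v * altprod a b k)%g ->
    ell w = (ell v + k)%N ->
    exists v k, [/\ w = (v * altprod a b k)%g, ell w = (ell v + k)%N &
      ell (v * val (if odd k then b else a))%g = (ell v).+1].
  by apply: (@strip (ell w) w 0%N); rewrite ?mulg1 ?addn0.
elim: n v k => [|n IHn] v k ev wE lw;
    case: (length_mul_gen v (if odd k then b else a)) => lv; try lia.
- by exists v, k.
- by exists v, k.
apply: (IHn (v * val (if odd k then b else a))%g k.+1); first lia.
  by rewrite /= -mulgA gen_mulgK.
by rewrite lw lv addnS.
Qed.

End CoxeterLength.

(** * Gram matrices with few values *)

(* A column of [G] is determined by its entries on [\rank G] suitable rows. *)
Lemma gram_size_bound (F : fieldType) (p n : nat) (G : 'M[F]_p) (L : seq F) :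
  G^T = G -> (\rank G <= n)%N -> (forall i j, G i j = 1 <-> i = j) ->
  (forall i j, G i j \in L) -> (p <= (size L).+1 ^ n)%N.
Proof.
move=> Gsym rG G1 GL.
have /submxP[D GE] : (G <= rowsub (maxrankfun G) G)%MS by rewrite eq_maxrowsub.
pose code (i : 'I_p) : {ffun 'I_(\rank G) -> 'I_(size L).+1} :=
  [ffun j => inord (index (G (maxrankfun G j) i) L)].
have codeI : injective code.
  (* Equal codes make the columns [i] and [k] equal, so that [G k i = G k k = 1] and [i = k]. *)
  move=> i k /ffunP eik; apply/G1; rewrite -[RHS](proj2 (G1 k k) erefl).
  rewrite -Gsym !mxE -Gsym !mxE -[in LHS]Gsym -[in RHS]Gsym ![G^T _ _]mxE.
  rewrite GE !mxE; apply: eq_bigr => j _; congr (_ * _).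
  rewrite !mxE; have := congr1 val (eik j); rewrite !ffunE /=.
  rewrite !inordK ?ltnS ?index_size // => e.
  by rewrite -[LHS](nth_index 0 (GL _ _)) e nth_index.
have := leq_card code codeI; rewrite card_ffun !card_ord => /leq_trans -> //.
exact: leq_pexp2l.
Qed.

(** * Degrees in the Hecke algebra *)

Section DegreeBound.

(** This bounds the degree in [v] from above; negative powers of [v] are unrestricted. *)
Definition degree_le (n : nat) (f : laurent) : Prop := in_Zvinv (vinv ^+ n * f).

Lemma in_Zvinv_add f g : in_Zvinv f -> in_Zvinv g -> in_Zvinv (f + g).
Proof.
by move=> [p ->] [q ->]; exists (p + q); rewrite rmorphD hornerD.
Qed.

Lemma in_Zvinv_mul f g : in_Zvinv f -> in_Zvinv g -> in_Zvinv (f * g).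
Proof.
by move=> [p ->] [q ->]; exists (p * q); rewrite rmorphM hornerM.
Qed.

Lemma in_Zvinv_opp f : in_Zvinv f -> in_Zvinv (- f).
Proof. by move=> [p ->]; exists (- p); rewrite rmorphN hornerN. Qed.

Lemma in_Zvinv1 : in_Zvinv 1.
Proof. by exists 1; rewrite rmorph1 hornerC. Qed.

Lemma in_Zvinv_exp n : in_Zvinv (vinv ^+ n).
Proof.
elim: n => [|n IHn]; first exact: in_Zvinv1.
rewrite exprS; apply: in_Zvinv_mul => //.
by exists 'X; rewrite map_polyX hornerX.
Qed.

Lemma degree_le0 n : degree_le n 0.
Proof. by rewrite /degree_le mulr0; exists 0; rewrite rmorph0 horner0. Qed.

Lemma degree_le1 n : degree_le n 1.
Proof. by rewrite /degree_le mulr1; exact: in_Zvinv_exp. Qed.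

Lemma degree_le_add n f g :
  degree_le n f -> degree_le n g -> degree_le n (f + g).
Proof. by rewrite /degree_le mulrDr; exact: in_Zvinv_add. Qed.

(** As [v^-l (v^l - v^-l) = 1 - v^(-2l)] lies in [Z[v^-1]], the factor raises the degree by at most
    [l]. *)
Lemma degree_le_quad n l k f : (n + l <= k)%N -> degree_le n f ->
  degree_le k ((vvar ^+ l - vinv ^+ l) * f).
Proof.
move=> nlk nf; rewrite /degree_le -(subnK nlk) !exprD.
have vl : vinv ^+ l * vvar ^+ l = 1 by rewrite -exprMn mulrC vvarK expr1n.
have -> : vinv ^+ (k - (n + l)) * (vinv ^+ n * vinv ^+ l) *
    ((vvar ^+ l - vinv ^+ l) * f) =
    vinv ^+ (k - (n + l)) * (1 - vinv ^+ l * vinv ^+ l) * (vinv ^+ n * f).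
  by rewrite -vl; ring.
apply: in_Zvinv_mul nf; apply: in_Zvinv_mul; first exact: in_Zvinv_exp.
apply: in_Zvinv_add in_Zvinv1 _; apply: in_Zvinv_opp.
by apply: in_Zvinv_mul; exact: in_Zvinv_exp.
Qed.

Variables (W : groupType) (H : algType laurent) (T : W -> H).

(** Basis elements may repeat in the list, so that sums are concatenations; [combination_lincomb]
    collects the terms. *)
Definition combination_degree_le n (h : H) : Prop :=
  exists l : seq (laurent * W), h = \sum_(i <- l) i.1 *: T i.2 /\
    {in l, forall i, degree_le n i.1}.

Lemma combination_basis n w : combination_degree_le n (T w).
Proof.
exists [:: (1, w)]; rewrite big_seq1 scale1r; split=> // i.
by rewrite inE => /eqP ->; exact: degree_le1.
Qed.

Lemma combination_add n h h' : combination_degree_le n h ->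
  combination_degree_le n h' -> combination_degree_le n (h + h').
Proof.
move=> [l [-> ln]] [l' [-> l'n]]; exists (l ++ l'); rewrite big_cat.
split=> // i.
by rewrite mem_cat => /orP[/ln|/l'n].
Qed.

Lemma combination_quad n l k h : (n + l <= k)%N -> combination_degree_le n h ->
  combination_degree_le k ((vvar ^+ l - vinv ^+ l) *: h).
Proof.
move=> nlk [r [-> rn]].
exists [seq ((vvar ^+ l - vinv ^+ l) * i.1, i.2) | i <- r]; split.
  by rewrite big_map scaler_sumr; apply: eq_bigr => i _; rewrite scalerA.
by move=> _ /mapP[i /rn ni ->]; exact: degree_le_quad ni.
Qed.

Lemma combination_lincomb n h : combination_degree_le n h ->
  exists2 c : {fsfun W -> laurent with 0},
    is_lincomb T c h & forall w, degree_le n (c w).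
Proof.
move=> [l [-> ln]]; pose A := [fset i.2 | i in l]%fset.
pose C w := \sum_(i <- l | i.2 == w) i.1.
exists [fsfun w in A => C w | 0]; last first.
  move=> w; rewrite fsfunE; case: ifP => _; last exact: degree_le0.
  rewrite /C big_seq_cond; elim/big_ind: _ => [|f g|i /andP[/ln]//].
    exact: degree_le0.
  exact: degree_le_add.
rewrite /is_lincomb; set c := [fsfun w in A => C w | 0].
rewrite (@big_fset_incl _ _ _ _ _ A) /=; last 2 first.
- exact: finsupp_sub.
- by move=> w _; rewrite mem_finsupp negbK => /eqP ->; rewrite scale0r.
rewrite (eq_big_seq (fun w => \sum_(i <- l | i.2 == w) i.1 *: T i.2)).
  rewrite (exchange_big_dep xpredT) //= [LHS]big_seq_cond [RHS]big_seq_cond.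
  apply: eq_bigr => i; rewrite andbT => il.
  have iA : i.2 \in A by apply/imfsetP; exists i.
  rewrite (big_rem _ iA) /= eqxx big_seq_cond big1 ?addr0 // => w /andP[].
  rewrite mem_rem_uniq ?fset_uniq // inE => /andP[/negPf wi _].
  by rewrite eq_sym wi.
move=> w wA; rewrite fsfunE wA /C scaler_suml.
by apply: eq_bigr => i /eqP ->.
Qed.

End DegreeBound.

(** * Roots, signs and descents *)

Section CoxeterRoots.
Variables (R : realType) (W : groupType) (S : {fset W}) (m : S -> S -> nat).
Hypotheses (mP : coxeter_matrix m) (presW : presented_by m).
Local Notation ell := (coxeter_length S).
Local Notation V := {ffun S -> R^o}.
Local Notation alpha := (@simple_root R S).
Variable act : W -> V -> V.
Hypotheses (act1 : forall x, act 1%g x = x)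
  (actM : forall w w' x, act (w * w')%g x = act w (act w' x))
  (act_gen : forall (s : S) x, act (val s) x = reflection m (alpha s) x).
Implicit Types (s t : S) (w v : W) (x y b c : V) (p q : R).

Let m_sym s t : m s t = m t s := (mP s t).1.
Let m_diag s t : m s t = 1%N <-> s = t := (mP s t).2.

(** Induction along a word for [w]. Closure under pointwise equality is asked because [act w] is
    only known pointwise as a composite of reflections. *)
Lemma act_ind (P : (V -> V) -> Prop) :
  (forall f g, f =1 g -> P f -> P g) ->
  P id -> (forall s f, P f -> P (fun x => reflection m (alpha s) (f x))) ->
  forall w, P (act w).
Proof.
move=> Pext P1 PS w; have [t _ ->] := reduced_word presW w.
elim: t => [|s t IHt].
  by apply: Pext P1 => x; rewrite /word_prod big_nil act1.
apply: Pext (PS s _ IHt) => x; rewrite -cat1s word_prod_cat actM word_prod1.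
by rewrite act_gen.
Qed.

Lemma actD w x y : act w (x + y) = act w x + act w y.
Proof.
move: w x y; apply: (act_ind (P := fun f =>
  forall x y, f (x + y) = f x + f y)) => [f g fg fD x y|//|s f fD x y].
  by rewrite -!fg.
by rewrite fD reflectionD.
Qed.

Lemma actZ w p x : act w (p *: x) = p *: act w x.
Proof.
move: w p x; apply: (act_ind (P := fun f =>
  forall p x, f (p *: x) = p *: f x)) => [f g fg fZ p x|//|s f fZ p x].
  by rewrite -!fg.
by rewrite fZ reflectionZ.
Qed.

Lemma actN w x : act w (- x) = - act w x.
Proof. by rewrite -scaleN1r actZ scaleN1r. Qed.

Lemma actB w x y : act w (x - y) = act w x - act w y.
Proof. by rewrite actD actN. Qed.

Lemma act_isom w x y : bform m (act w x) (act w y) = bform m x y.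
Proof.
move: w x y; apply: (act_ind (P := fun f =>
  forall x y, bform m (f x) (f y) = bform m x y))
  => [f g fg fI x y|//|s f fI x y].
  by rewrite -!fg.
by rewrite reflection_isom // bform_simple1.
Qed.

Lemma actK w : cancel (act w) (act w^-1%g).
Proof. by move=> x; rewrite -actM mulVg act1. Qed.

Lemma actVK w : cancel (act w^-1%g) (act w).
Proof. by move=> x; rewrite -actM mulgV act1. Qed.

Lemma act_genK s : involutive (act (val s)).
Proof. by move=> x; rewrite -actM (genK mP presW) act1. Qed.

Lemma act_gen_simple s : act (val s) (alpha s) = - alpha s.
Proof. by rewrite act_gen reflection_self // bform_simple1. Qed.

(** * Positive and negative roots *)

(** On roots its negation means negative, by [root_pos_opp]; on arbitrary vectors it need not. *)
Definition pos x : bool := [forall s, 0 <= x s].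

Lemma posD x y : pos x -> pos y -> pos (x + y).
Proof.
move=> /forallP px /forallP py; apply/forallP => s.
by rewrite ffunE addr_ge0.
Qed.

Lemma posZ p x : 0 <= p -> pos x -> pos (p *: x).
Proof.
move=> p0 /forallP px; apply/forallP => s.
by rewrite ffunE mulr_ge0.
Qed.

Lemma pos_simple s : pos (alpha s).
Proof. by apply/forallP => t; rewrite ffunE; case: eqP. Qed.

Lemma pos_anti x : pos x -> pos (- x) -> x = 0.
Proof.
move=> /forallP px /forallP nx; apply/ffunP => s; rewrite !ffunE.
by apply/eqP; rewrite eq_le px -oppr_ge0 andbT; have := nx s; rewrite ffunE.
Qed.

Definition is_root x : Prop := exists w s, x = act w (alpha s).

Lemma root_act w x : is_root x -> is_root (act w x).
Proof. by move=> [v [s ->]]; exists (w * v)%g, s; rewrite actM. Qed.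

Lemma root_simple s : is_root (alpha s).
Proof. by exists 1%g, s; rewrite act1. Qed.

Lemma root_opp x : is_root x -> is_root (- x).
Proof.
move=> [v [s ->]]; exists (v * val s)%g, s.
by rewrite actM act_gen_simple actN.
Qed.

Lemma root_norm x : is_root x -> bform m x x = 1.
Proof. by move=> [v [s ->]]; rewrite act_isom bform_simple1. Qed.

Lemma root_neq0 x : is_root x -> x <> 0.
Proof.
move=> /root_norm + x0; rewrite x0 -(scale0r x) bformZl mul0r.
by move/esym/eqP; rewrite oner_eq0.
Qed.

Lemma root_reflection b x :
  is_root b -> is_root x -> is_root (reflection m b x).
Proof.
move=> [w [s ->]] rx.
suff -> : reflection m (act w (alpha s)) x = act (w * val s * w^-1)%g x.
  exact: root_act.
rewrite !actM act_gen /reflection actB actZ actVK.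
by rewrite -(act_isom w (act _ x)) actVK.
Qed.

(** Each further factor performs one step of the Chebyshev recurrence, alternately on the
    coefficients of [alpha t] and [alpha s]. *)
Lemma act_altprod s t k :
  let c := - cox_coef R m s t in
  act (altprod t s k) (alpha s) =
  if odd k then cheb c k *: alpha s + cheb c k.+1 *: alpha t
  else cheb c k.+1 *: alpha s + cheb c k *: alpha t.
Proof.
move=> c; elim: k => [|k IHk]; first by rewrite /= act1 scale1r scale0r addr0.
rewrite [altprod _ _ _]/= actM {}IHk act_gen [odd k.+1]/=.
case: (odd k); last first.
  by rewrite reflection_step // -/c chebSS.
by rewrite addrC reflection_step // (cox_coef_sym _ m_sym) -/c addrC chebSS.
Qed.

(* The action of [w] on the simple root [alpha s] detects the right descents:
   stripping an alternating suffix in [s] and a descent [t] of [w] reduces to a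
   computation in the plane of [alpha s] and [alpha t]. *)
Lemma pos_act_simple w s : ell (w * val s)%g = (ell w).+1 ->
  pos (act w (alpha s)).
Proof.
have [n] := ubnP (ell w); elim: n w s => // n IHn w s lwn lws.
have [->|w1] := eqVneq w 1%g; first by rewrite act1 pos_simple.
have [t lwt] := right_descent mP presW w1.
have st : s != t by apply/eqP => e; subst t; lia.
have [v [k [wE lw lv]]] := strip_altprod mP presW w t s.
case: k => [|k] in wE lw lv *.
  by move: lv lwt; rewrite wE /= mulg1 => lv; rewrite lv; lia.
(* If the length of [v] dropped here, [w] would be shorter than [ell v + k + 1]. *)
have lv' : ell (v * val (if odd k then s else t))%g = (ell v).+1.
  case: (length_mul_gen mP presW v (if odd k then s else t)) => // lv'.
  have := lengthM presW (v * val (if odd k then s else t)) (altprod t s k).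
  have := length_altprod presW t s k.
  have := lw; rewrite {1}wE altprodS mulgA => -> h1 h2.
  have h3 := leq_trans h2 (leq_add (leqnn _) h1).
  lia.
have [pvs pvt] : pos (act v (alpha s)) /\ pos (act v (alpha t)).
  move: lv lv' => /=; case: (odd k) => /= l1 l2; split;
    by apply: IHn => //; lia.
(* If [m s t <= k + 1], multiplying the alternating suffix by [s] would shorten it, although [w s]
   is longer than [w]. *)
have mk : m s t = 0%N \/ (k.+2 <= m s t)%N.
  have [->|m0] := eqVneq (m s t) 0%N; [by left | right].
  rewrite ltnNge; apply/negP => mk.
  have := length_altprod_braid mP presW m0 mk.
  have := lengthM presW v (altprod t s k.+1 * val s)%g.
  by rewrite mulgA -wE lws; lia.
have c1 : 0 <= cheb (- cox_coef R m s t : R) k.+1.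
  by apply: (cheb_ge0 R m_diag) => //; case: mk; [left | right; lia].
have c2 : 0 <= cheb (- cox_coef R m s t : R) k.+2.
  by apply: (cheb_ge0 R m_diag).
rewrite wE actM act_altprod.
by case: ifP => _; rewrite actD !actZ posD ?posZ.
Qed.

Lemma neg_act_simple w s : ell w = (ell (w * val s)%g).+1 ->
  pos (- act w (alpha s)).
Proof.
move=> lw; have := @pos_act_simple (w * val s)%g s.
rewrite (mulg_genK mP presW) lw actM act_gen_simple actN; exact.
Qed.

Lemma root_pos_opp x : is_root x -> pos (- x) = ~~ pos x.
Proof.
move=> rx; have [w [s xE]] := rx.
apply/idP/idP => [px|/negP npx].
  by apply/negP => /pos_anti /(_ px); exact: root_neq0.
case: (length_mul_gen mP presW w s) => [/pos_act_simple|/neg_act_simple].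
  by rewrite -xE => /npx.
by rewrite -xE.
Qed.

Lemma act_gen_shift v s x :
  act v (act (val s) x) =
  act v x + (2 * bform m x (alpha s)) *: - act v (alpha s).
Proof. by rewrite act_gen /reflection actB actZ scalerN. Qed.

Lemma neg_shift p x y : is_root x -> is_root y -> is_root (x + p *: y) ->
  0 <= p -> ~~ pos x -> ~~ pos y -> ~~ pos (x + p *: y).
Proof.
move=> rx ry rxy p0 nx ny; rewrite -root_pos_opp // opprD -scalerN.
by rewrite posD ?posZ ?root_pos_opp.
Qed.

(** The reflection changes only the coordinate at [s]: a positive coordinate elsewhere keeps the
    root positive, and without one the root is a positive multiple of [alpha s] of norm 1. *)
Lemma root_gen_pos b s : is_root b -> pos b -> b <> alpha s ->
  pos (act (val s) b).
Proof.
move=> rb pb bs; have /forallP pb' := pb.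
have [/existsP [t /andP[ts bt]]|] :=
    boolP [exists t, (t != s) && (b t != 0)].
  apply: contraT; rewrite -root_pos_opp; last exact: root_act.
  move=> /forallP /(_ t); rewrite act_gen /reflection !ffunE (negPf ts).
  rewrite scaler0 subr0 oppr_ge0 => bt0.
  by case/eqP: bt; apply/eqP; rewrite eq_le bt0 pb'.
rewrite negb_exists => /forallP b0.
have bE : b = b s *: alpha s.
  apply/ffunP => t; rewrite !ffunE; have := b0 t; rewrite negb_and !negbK.
  have [->|_ /= /eqP ->] := eqVneq t s; rewrite ?scaler0 //.
  by rewrite /GRing.scale /= mulr1.
have := root_norm rb.
rewrite {1 2}bE bformZl (bformZr m_sym) bform_simple1 // mulr1 => /eqP.
rewrite -expr2 sqrf_eq1 => /orP[/eqP b1|/eqP b1].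
  by case: bs; rewrite bE b1 scale1r.
by have := pb' s; rewrite b1 oppr_ge0 ler10.
Qed.

(** * Crossing roots and folds *)

Definition crossing b c : Prop := forall e1 e2 : bool,
  exists v, pos (act v b) = e1 /\ pos (act v c) = e2.

(** On roots this is the dominance order of Brink and Howlett. *)
Definition dominates b c : Prop :=
  forall v, ~~ pos (act v b) -> ~~ pos (act v c).

Lemma crossing_sym b c : crossing b c -> crossing c b.
Proof. by move=> bc e1 e2; have [v []] := bc e2 e1; exists v. Qed.

Lemma crossing_act w b c : crossing b c -> crossing (act w b) (act w c).
Proof.
move=> bc e1 e2; have [v [<- <-]] := bc e1 e2.
by exists (v * w^-1)%g; rewrite !actM !actK.
Qed.

Lemma crossing_oppl b c : is_root b -> crossing b c -> crossing (- b) c.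
Proof.
move=> rb bc e1 e2; have [v [vb vc]] := bc (~~ e1) e2.
exists v; rewrite actN root_pos_opp; last exact: root_act.
by rewrite vb negbK.
Qed.

Lemma crossing_irr b : ~ crossing b b.
Proof. by move=> /(_ true false) [v [-> ]]. Qed.

Lemma crossing_ndom b c : crossing b c -> ~ dominates b c.
Proof.
by move=> /(_ false true) [v [vb vc]] /(_ v); rewrite vb vc => /(_ isT).
Qed.

Lemma dom_trans b c d : dominates b c -> dominates c d -> dominates b d.
Proof. by move=> bc cd v /bc /cd. Qed.

Lemma dom_act w b c : dominates b c -> dominates (act w b) (act w c).
Proof. by move=> bc v; rewrite -!actM; exact: bc. Qed.

Lemma dom_gen s b c :
  dominates b (act (val s) c) -> dominates (act (val s) b) c.
Proof. by move=> /(dom_act (w := val s)); rewrite act_genK. Qed.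

(* If [v] separates [b] and [c] in the required way, then [v] or [v s] separates
   [b] and [s c] likewise, according to the sign of [v (alpha s)]. *)
Lemma ndom_gen s b c : is_root b -> is_root c -> crossing b c ->
  0 <= bform m b (alpha s) * bform m c (alpha s) ->
  ~ dominates b (act (val s) c).
Proof.
move=> rb rc bc bcs D; have [v [vb vc]] := bc false true.
have E x : act (v * val s)%g x = act v (act (val s) x) by rewrite actM.
have rv x : is_root x -> is_root (act v x) by exact: root_act.
have rva : is_root (act v (alpha s)) by exact/rv/root_simple.
have rvsb : is_root (act v (act (val s) b)) by exact/rv/root_act.
have D1 : ~~ pos (act v (act (val s) c)) by apply: D; rewrite vb.
have D2 : pos (act v (act (val s) b)).
  by have := D (v * val s)%g; rewrite !E act_genK vc; case: pos => // /(_ isT).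
have rvab := root_opp rva.
have shiftN x p : act v x + (2 * p) *: - act v (alpha s) =
    act v x + (- (2 * p)) *: act v (alpha s) by rewrite scalerN scaleNr.
(* Now [v b < 0 < v s b] and [v s c < 0 < v c]. Both changes of sign come from multiples of
   [v (alpha s)], so the two values of the form have strictly opposite signs. *)
move: bcs; apply/negP; rewrite -ltNge.
have [va|va] := boolP (pos (act v (alpha s))).
- have b0 : bform m b (alpha s) < 0.
    rewrite ltNge; apply/negP => b0; move: D2; apply/negP.
    rewrite act_gen_shift neg_shift ?root_pos_opp ?va ?vb ?mulr_ge0 //.
    + exact: rv.
    + by rewrite -act_gen_shift.
  rewrite nmulr_rlt0 // ltNge; apply: contra D1 => c0.
  by rewrite act_gen_shift shiftN posD ?vc // posZ // oppr_ge0 pmulr_rle0.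
- have b0 : 0 < bform m b (alpha s).
    rewrite ltNge; apply/negP => b0; move: D2; apply/negP.
    rewrite act_gen_shift shiftN neg_shift ?va ?vb ?oppr_ge0 ?pmulr_rle0 //.
    + exact: rv.
    + by rewrite -shiftN -act_gen_shift.
  rewrite pmulr_rlt0 // ltNge; apply: contra D1 => c0.
  by rewrite act_gen_shift posD ?vc // posZ ?root_pos_opp // mulr_ge0.
Qed.

(* For [U = u^-1] these are the positive roots whose hyperplane separates [w]
   both from [1] and from [w u]. *)
Definition backtracks w U b : Prop :=
  [/\ is_root b, pos b, ~~ pos (act w b) & ~~ pos (act U b)].

Definition crossing_family (M : seq V) : Prop :=
  uniq M /\ {in M &, forall b c, b <> c -> crossing b c}.

(** The patterns with equal signs occur at [1] and [w], the mixed ones at the witnesses of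
    non-dominance. *)
Lemma backtracks_crossing w U b c : backtracks w U b -> backtracks w U c ->
  ~ dominates b c -> ~ dominates c b -> crossing b c.
Proof.
move=> [rb pb wb _] [rc pc wc _] bc cb.
have sep x y : ~ dominates x y -> exists v, ~~ pos (act v x) /\ pos (act v y).
  by move=> /existsNP[v /not_implyP[vx /negP]]; rewrite negbK; exists v.
case=> [] [].
- by exists 1%g; rewrite !act1.
- by have [v [vc vb]] := sep _ _ cb; exists v; rewrite vb (negPf vc).
- by have [v [vb vc]] := sep _ _ bc; exists v; rewrite vc (negPf vb).
- by exists w; rewrite (negPf wb) (negPf wc).
Qed.

(** The family is moved by [s], which permutes the positive roots other than [alpha s]; and
    [alpha s] is not in [M], because [U] keeps it positive. *)
Lemma crossing_family_step w U s M :
  (forall b, b \in M -> backtracks (w * val s)%g U b) ->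
  pos (act U (alpha s)) -> crossing_family M ->
  exists M', [/\ size M' = size M, crossing_family M' &
    forall b, b \in M' -> backtracks w (U * val s)%g b].
Proof.
move=> btM pU [uM cM]; exists [seq act (val s) b | b <- M]; split.
- by rewrite size_map.
- split; first by rewrite map_inj_uniq //; exact: (can_inj (act_genK s)).
  move=> _ _ /mapP[b bM ->] /mapP[c cc ->] bc.
  by apply: crossing_act; apply: cM => // e; apply: bc; rewrite e.
- move=> _ /mapP[b /btM [rb pb wb Ub] ->].
  split; rewrite ?actM ?act_genK //; first exact: root_act.
  + by apply: root_gen_pos => // e; rewrite e pU in Ub.
  + by rewrite -actM.
Qed.

(** * Enlarging a crossing family at a fold *)

Section Fold.
Variables (w U : W) (s : S) (M : seq V).
Hypotheses (ws : ~~ pos (act w (alpha s))) (Us : pos (act U (alpha s))).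
Hypotheses (crM : crossing_family M)
  (btM : forall b, b \in M -> backtracks w U b).
Local Notation ip b := (bform m b (alpha s)).

Let dom_eq b c : b \in M -> c \in M -> dominates b c -> b = c.
Proof.
by move=> bM cc bc; apply: contrapT => /(crM.2 _ _ bM cc)/crossing_ndom.
Qed.

Let dom_gen_lt0 b c : b \in M -> c \in M -> b <> c ->
  dominates b (act (val s) c) -> ip b * ip c < 0.
Proof.
move=> bM cc bc D; rewrite ltNge; apply/negP => /ndom_gen; apply=> //.
- by case: (btM bM).
- by case: (btM cc).
- exact: crM.2.
Qed.

(* Join [b] and [c] when [b] dominates [s c]; the reflected roots are the
   negative sources of this graph (with respect to the sign of [ip]), together
   with their neighbours.  No edge leads out of this set, so that the roots of
   [fold_root] stay pairwise crossing. *)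
Definition source b : Prop :=
  forall c, c \in M -> 0 < ip c -> ~ dominates c (act (val s) b).

Definition reflected b : Prop :=
  if ip b < 0 then source b else
  exists c, [/\ c \in M, ip c < 0, source c & dominates c (act (val s) b)].

Definition fold_root b : V := if `[< reflected b >] then act (val s) b else b.

(** The four sign patterns of [(alpha s, b)] occur at [1], [U], [s] and [w]. For a reflected root
    they are transported by [s], which negates [alpha s]. *)
Lemma fold_root_crossing_simple b : b \in M -> crossing (alpha s) (fold_root b).
Proof.
move=> bM; have [rb pb wb Ub] := btM bM.
have ab : crossing (alpha s) b.
  case=> [] [].
  - by exists 1%g; rewrite !act1 pos_simple.
  - by exists U; rewrite Us (negPf Ub).
  - exists (val s).
    rewrite act_gen_simple root_pos_opp; last exact: root_simple.
    rewrite pos_simple root_gen_pos //.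
    by move=> e; move: Ub; rewrite e Us.
  - by exists w; rewrite (negPf ws) (negPf wb).
rewrite /fold_root; case: asboolP => // _.
rewrite -[alpha s]opprK -act_gen_simple; apply: crossing_oppl.
  exact/root_act/root_simple.
exact: crossing_act.
Qed.

(** The essential sign is that of [w (s b)] if [b] is reflected and of [U (s b)] if not. Either the
    sign of [ip b] makes this root a non-negative combination of negative roots, or a member of [M]
    dominates [s b]. *)
Lemma fold_root_backtracks b : b \in M ->
  backtracks w (U * val s)%g (fold_root b).
Proof.
move=> bM; have [rb pb wb Ub] := btM bM.
have rs := root_simple s; have rsb := root_act (val s) rb.
rewrite /fold_root /reflected; case: asboolP => [|nref].
- case: ifPn => [b0 _|b0 [c [cc c0 _ cb]]].
  + split=> //; last by rewrite actM act_genK.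
      by apply: root_gen_pos => // e; move: Ub; rewrite e Us.
    rewrite act_gen_shift scalerN -scaleNr neg_shift //; try exact: root_act.
      by rewrite scaleNr -scalerN -act_gen_shift; exact: root_act.
    by rewrite oppr_ge0 pmulr_rle0 ?ltW.
  + split=> //; last by rewrite actM act_genK.
      by apply: root_gen_pos => // e; move: Ub; rewrite e Us.
    by apply: cb; case: (btM cc).
- split=> //; rewrite actM; move: nref; case: ifPn => [b0|b0 _].
  + move=> /existsNP[c /not_implyP[cc /not_implyP[c0 /contrapT D]]].
    by apply: D; case: (btM cc).
  + rewrite act_gen_shift neg_shift ?root_pos_opp ?Us //.
    * exact: root_act.
    * exact/root_opp/root_act.
    * by rewrite -act_gen_shift; exact: root_act.
    * by rewrite mulr_ge0 // leNgt.
    * exact: root_act.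
Qed.

(** By [dom_gen_lt0], edges join roots with [ip] of strictly opposite signs. Consecutive edges from
    [d] to [c] to [b] force [d = b]: [d] dominates [s c], which dominates [b], and distinct members
    of [M] cross. *)
Lemma reflected_edge b c : b \in M -> c \in M ->
  reflected b -> ~ reflected c -> ~ dominates c (act (val s) b) /\
  ~ dominates b (act (val s) c).
Proof.
move=> bM cc rb rc.
have bc : b <> c by move=> e; rewrite e in rb.
suff no_in : ~ dominates b (act (val s) c).
  split=> // D; have := dom_gen_lt0 cc bM (nesym bc) D.
  move: rb rc; rewrite /reflected.
  case: (ltP (ip b) 0) => b0.
    rewrite nmulr_llt0 // => sb _ c0; exact: sb _ cc c0 D.
  move=> _; case: ifPn => [c0|c0 _]; last first.
    by rewrite ltNge mulr_ge0 // leNgt.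
  move=> /existsNP[d /not_implyP[dM /not_implyP[d0 /contrapT dc]]] _.
  have db : d = b.
    apply: dom_eq => //; apply: dom_trans dc _.
    have := dom_gen D => {}D v vc; apply: D; exact: vc.
  by apply: no_in; rewrite -db.
move=> D; have := dom_gen_lt0 bM cc bc D; have := rb; rewrite /reflected.
case: (ltP (ip b) 0) => b0.
  rewrite nmulr_rlt0 // => sb c0; apply: rc; rewrite /reflected.
  by rewrite ltNge (ltW c0) /=; exists b.
move=> [d [dM d0 sd db]] _.
have dc : d = c by apply: dom_eq => //; apply: dom_trans db (dom_gen D).
by apply: rc; rewrite /reflected -dc d0.
Qed.

(** Pairs of the same kind inherit crossing from [M]; for mixed pairs the absence of edges gives
    both non-dominances. *)
Lemma fold_root_crossing b c : b \in M -> c \in M -> b <> c ->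
  crossing (fold_root b) (fold_root c).
Proof.
suff mixed x y : x \in M -> y \in M -> reflected x -> ~ reflected y ->
    crossing (fold_root x) (fold_root y).
  move=> bM cc bc.
  case: (pselect (reflected b)) => rb; case: (pselect (reflected c)) => rc.
  - by rewrite /fold_root (asboolT rb) (asboolT rc); exact/crossing_act/crM.2.
  - exact: mixed.
  - exact/crossing_sym/mixed.
  - by rewrite /fold_root (asboolF rb) (asboolF rc); exact: crM.2.
move=> xM yM rx ry; have [yx xy] := reflected_edge xM yM rx ry.
apply: (backtracks_crossing (fold_root_backtracks xM)
                            (fold_root_backtracks yM)).
  rewrite /fold_root (asboolT rx) (asboolF ry) => D; apply: xy.
  by rewrite -[x](act_genK s); exact: dom_act.
by rewrite /fold_root (asboolT rx) (asboolF ry).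
Qed.

Lemma crossing_family_fold : exists M', [/\ size M' = (size M).+1,
  crossing_family M' & forall b, b \in M' -> backtracks w (U * val s)%g b].
Proof.
have inj : {in M &, injective fold_root}.
  move=> b c bM cc e; apply: contrapT => bc.
  by have := fold_root_crossing bM cc bc; rewrite e => /crossing_irr.
have aM b : b \in M -> alpha s <> fold_root b.
  by move=> /fold_root_crossing_simple + e; rewrite -e => /crossing_irr.
exists (alpha s :: map fold_root M); split.
- by rewrite /= size_map.
- split.
    rewrite /= map_inj_in_uniq // crM.1 andbT; apply/negP => /mapP[b bM].
    exact: aM.
  move=> b c; rewrite !inE.
  move=> /predU1P[->|/mapP[b' bM ->]] /predU1P[->|/mapP[c' cc ->]] //.
  + by move=> _; exact: fold_root_crossing_simple.
  + by move=> _; exact/crossing_sym/fold_root_crossing_simple.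
  + by move=> e; apply: fold_root_crossing => // e'; apply: e; rewrite e'.
- move=> b; rewrite inE => /predU1P[->|/mapP[c cc ->]].
    split; rewrite ?pos_simple //; first exact: root_simple.
    rewrite actM act_gen_simple actN root_pos_opp ?Us //.
    exact/root_act/root_simple.
  exact: fold_root_backtracks.
Qed.

End Fold.

(** * Families of pairwise crossing roots are bounded *)

(** For a right descent [s], the inversions of [w] are [alpha s] and the images under [s] of those
    of [w s]. *)
Lemma inversions_finite w : exists E : seq V,
  forall b, is_root b -> pos b -> ~~ pos (act w b) -> b \in E.
Proof.
have [n] := ubnP (ell w); elim: n w => // n IHn w lw.
have [->|/(right_descent mP presW)[s ws]] := eqVneq w 1%g.
  by exists [::] => b _ pb; rewrite act1 pb.
have [|E HE] := IHn (w * val s)%g; first lia.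
exists (alpha s :: map (act (val s)) E) => b rb pb wb.
have [->|/eqP bs] := eqVneq b (alpha s); first by rewrite mem_head.
rewrite inE -[b in X in _ || X](act_genK s) map_f ?orbT //.
apply: HE; first exact: root_act.
  exact: root_gen_pos.
by rewrite actM act_genK.
Qed.

Lemma separating_finite v w : exists E : seq V,
  forall b, is_root b -> pos (act v b) -> ~~ pos (act w b) -> b \in E.
Proof.
have [E HE] := inversions_finite (w * v^-1)%g.
exists (map (act v^-1%g) E) => b rb vb wb; rewrite -[b](actK v) map_f //.
by apply: HE => //; [exact: root_act | rewrite actM actK].
Qed.

(* If the form takes the value [1], the dihedral group of [b] and [c] produces
   the roots [b + 2 k (b - c)], which are all separated by two elements of [W]
   with signs [(+, -)] and [(-, +)] on [(b, c)]. *)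
Lemma crossing_bform_neq1 b c : is_root b -> is_root c -> crossing b c ->
  bform m b c != 1.
Proof.
move=> rb rc cr; apply/negP => /eqP bc1.
pose d := b - c.
have rk k : is_root (b + (k%:R * 2) *: d).
  elim: k => [|k IHk]; first by rewrite mul0r scale0r addr0.
  (* Reflecting in [c] and then in [b] adds [2 d], because [d] is orthogonal to [b] and [c]. *)
  have := root_reflection rb (root_reflection rc IHk).
  congr is_root; set x := b + _.
  have xc : bform m x c = 1.
    by rewrite /x /d !(bformE R m_sym) bc1 root_norm // subrr mulr0 addr0.
  have xb : bform m x b = 1.
    rewrite /x /d !(bformE R m_sym) (bformC m_sym c) bc1 root_norm //.
    by rewrite subrr mulr0 addr0.
  rewrite /reflection xc bformBl bformZl (bformC m_sym c) bc1 xb.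
  rewrite !mulr1 (_ : 2 * (1 - 2) = - 2); last ring.
  rewrite scaleNr opprK -addrA [- _ + _]addrC -scalerBr -/d /x -addrA.
  by rewrite -scalerDl; congr (_ + _ *: _); rewrite -addn1 natrD; ring.
have [v [vb /negbT vc]] := cr true false.
have [w [/negbT wb wc]] := cr false true.
have [E HE] := separating_finite v w.
have k2 k : 0 <= (k%:R * 2 : R) by rewrite mulr_ge0.
have vd : pos (act v d).
  by rewrite actB posD // root_pos_opp //; exact: root_act.
have wd : pos (- act w d).
  by rewrite actB opprB posD // root_pos_opp //; exact: root_act.
have inE k : b + (k%:R * 2) *: d \in E.
  apply: HE => //; rewrite ?actD ?actZ; first by rewrite posD ?posZ.
  rewrite -root_pos_opp; last by rewrite -actZ -actD; exact: root_act.
  rewrite opprD -scalerN posD ?posZ // root_pos_opp //; exact: root_act.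
have d0 : d != 0.
  by rewrite subr_eq0; apply/eqP => e; move: cr; rewrite e => /crossing_irr.
(* These are distinct roots, one more than [E] has entries. *)
have u : uniq (mkseq (fun k => b + (k%:R * 2) *: d) (size E).+1).
  apply/mkseq_uniqP => i j _ _ /addrI /eqP.
  rewrite -subr_eq0 -scalerBl scaler_eq0 (negPf d0) orbF -mulrBl mulf_eq0.
  by rewrite pnatr_eq0 orbF subr_eq0 eqr_nat => /eqP.
have /(uniq_leq_size u) :
    {subset mkseq (fun k => b + (k%:R * 2) *: d) (size E).+1 <= E}.
  by move=> _ /mapP[k _ ->].
by rewrite size_mkseq ltnn.
Qed.

(** * Reduction to finite standard parabolic subsystems *)

Definition linear_functional (p : V -> R) : Prop :=
  (forall x y, p (x + y) = p x + p y) /\ (forall k x, p (k *: x) = k * p x).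

(** If [p (alpha s) < 0], passing to the composite of [p] with [s] shortens [E] by one entry, since
    [s] permutes the positive roots other than [alpha s]. *)
Lemma to_fundamental_chamber (p : V -> R) (E : seq V) : linear_functional p ->
  (forall b, is_root b -> pos b -> p b < 0 -> b \in E) ->
  exists w, forall s, 0 <= p (act w (alpha s)).
Proof.
have [n] := ubnP (size E); elim: n p E => // n IHn p E szE [pD pZ] HE.
have [/forallP p0|] := boolP [forall s, 0 <= p (alpha s)].
  by exists 1%g => s; rewrite act1.
rewrite negb_forall => /existsP[s]; rewrite -ltNge => ps.
have sE : alpha s \in E.
  by apply: HE => //; [exact: root_simple | exact: pos_simple].
have pN x : p (- x) = - p x by rewrite -scaleN1r pZ mulN1r.
have [||b rb pb psb|w Hw] :=
    IHn (p \o act (val s)) (map (act (val s)) (rem (alpha s) E)).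
- by rewrite size_map size_rem //; case: (E) szE sE.
- by split=> [x y|k x]; rewrite /= ?actD ?actZ.
- have bs : b <> alpha s.
    move=> e; move: psb; rewrite e /= act_gen_simple pN oppr_lt0.
    by rewrite ltNge ltW.
  rewrite -[b](act_genK s) map_f // rem_mem //.
    apply/eqP => e; move: pb; rewrite -[b](act_genK s) e act_gen_simple.
    by rewrite root_pos_opp ?pos_simple //; exact: root_simple.
  by apply: HE => //; [exact: root_act | exact: root_gen_pos].
by exists (val s * w)%g => t; rewrite actM; exact: Hw.
Qed.

Definition height x : R := \sum_s x s.

Lemma heightD x y : height (x + y) = height x + height y.
Proof. by rewrite /height -big_split; apply: eq_bigr => s _; rewrite ffunE. Qed.

Lemma heightZ k x : height (k *: x) = k * height x.
Proof. by rewrite /height mulr_sumr; apply: eq_bigr => s _; rewrite ffunE. Qed.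

Lemma height_gt0 x : is_root x -> pos x -> 0 < height x.
Proof.
move=> rx /forallP px; rewrite lt_def sumr_ge0 // andbT.
apply/negP => /eqP /psumr_eq0P h0; apply: (root_neq0 rx); apply/ffunP => s.
by rewrite ffunE h0.
Qed.

Lemma height_lt0 x : is_root x -> ~~ pos x -> height x < 0.
Proof.
move=> rx nx; rewrite -oppr_gt0 -mulN1r -heightZ scaleN1r height_gt0 //.
  exact: root_opp.
by rewrite root_pos_opp.
Qed.

(* The functional is a convex combination of the heights of [v x], where [v]
   runs over elements realising the four sign patterns on [(b, c)]. *)
Lemma crossing_functional b c : is_root b -> is_root c -> crossing b c ->
  exists p : V -> R, [/\ linear_functional p, p b = 0, p c = 0 &
    exists E : seq V, forall x, is_root x -> pos x -> p x <= 0 -> x \in E].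
Proof.
move=> rb rc cr.
have H v x : is_root x -> if pos (act v x) then 0 < height (act v x)
    else height (act v x) < 0.
  by move=> rx; case: ifPn => vx; [apply: height_gt0 | apply: height_lt0] => //;
     exact: root_act.
have [v1 [vb1 vc1]] := cr true true; have [v2 [vb2 vc2]] := cr false true.
have [v3 [vb3 vc3]] := cr true false; have [v4 [vb4 vc4]] := cr false false.
have := (H v1 b rb, H v2 b rb, H v3 b rb, H v4 b rb).
have := (H v1 c rc, H v2 c rc, H v3 c rc, H v4 c rc).
rewrite vb1 vb2 vb3 vb4 vc1 vc2 vc3 vc4.
pose h v x := height (act v x); rewrite -!/(h _ _).
move=> [[[c1 c2] c3] c4] [[[b1 b2] b3] b4].
(* Both brackets of [p] below vanish at [b]; at [c] they take the values [P] and [- Q], which the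
   weights [Q] and [P] cancel. *)
pose P := h v1 b * h v2 c - h v2 b * h v1 c.
pose Q := h v4 b * h v3 c - h v3 b * h v4 c.
have P0 : 0 < P by rewrite /P; nra.
have Q0 : 0 < Q by rewrite /Q; nra.
pose p x := Q * (h v1 b * h v2 x - h v2 b * h v1 x)
  + P * (h v3 b * h v4 x - h v4 b * h v3 x).
have hD v x y : h v (x + y) = h v x + h v y by rewrite /h actD heightD.
have hZ v k x : h v (k *: x) = k * h v x by rewrite /h actZ heightZ.
exists p; split.
- by split=> [x y|k x]; rewrite /p ?hD ?hZ; ring.
- by rewrite /p; ring.
- by rewrite /p /P /Q; ring.
have [E1 HE1] := inversions_finite v1; have [E2 HE2] := inversions_finite v2.
have [E3 HE3] := inversions_finite v3; have [E4 HE4] := inversions_finite v4.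
(* All four heights enter [p] with positive coefficients, so [p x <= 0] forces one of the four
   elements to make [x] negative. *)
exists (E1 ++ E2 ++ E3 ++ E4) => x rx px; rewrite !mem_cat; apply: contraTT.
rewrite !negb_or -ltNge => /and4P[n1 n2 n3 n4].
have pv v (E : seq V) :
    (forall b, is_root b -> pos b -> ~~ pos (act v b) -> b \in E) ->
    x \notin E -> 0 < h v x.
  move=> HE nx; apply: height_gt0; first exact: root_act.
  by apply: contraNT nx; exact: HE.
have := (pv _ _ HE1 n1, pv _ _ HE2 n2, pv _ _ HE3 n3, pv _ _ HE4 n4).
move=> [[[x1 x2] x3] x4]; rewrite /p addr_gt0 // mulr_gt0 //; nra.
Qed.

Definition supported (J : {set S}) x : Prop := forall s, s \notin J -> x s = 0.

Lemma simple_expansion x : x = \sum_s x s *: alpha s.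
Proof.
apply/ffunP => t; rewrite sum_ffunE (bigD1 t) //= big1 ?addr0.
  by rewrite !ffunE eqxx /GRing.scale /= mulr1.
by move=> s /negPf st; rewrite !ffunE eq_sym st scaler0.
Qed.

(** Once [p] is moved to the closed fundamental chamber, a root in its kernel is supported on the
    set [J] of simple roots killed there, as its coordinates have one sign. Conversely, roots
    supported on [J] lie in the kernel, hence in [E] up to sign and the action. *)
Lemma crossing_finite_parabolic b c : is_root b -> is_root c -> crossing b c ->
  exists w (J : {set S}) (E : seq V),
    [/\ supported J (act w b), supported J (act w c) &
        forall x, is_root x -> supported J x -> x \in E].
Proof.
move=> rb rc cr; have [p [lp pb pc [E HE]]] := crossing_functional rb rc cr.
have [|w Hw] := to_fundamental_chamber (E := E) lp.
  by move=> x rx px /ltW; exact: HE.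
have [pD pZ] := lp.
have pN x : p (- x) = - p x by rewrite -scaleN1r pZ mulN1r.
pose q x := p (act w x).
have qZ k x : q (k *: x) = k * q x by rewrite /q actZ pZ.
have qN x : q (- x) = - q x by rewrite /q actN pN.
have q0 : q 0 = 0 by rewrite -(scale0r 0) qZ mul0r.
have qE x : q x = \sum_s x s * q (alpha s).
  rewrite {1}[x]simple_expansion (big_morph q (id1 := 0) (op1 := +%R)) //.
    by apply: eq_bigr => s _; rewrite qZ.
  by move=> y z; rewrite /q actD pD.
pose J : {set S} := [set s | q (alpha s) == 0].
have suppP x : pos x -> q x = 0 -> supported J x.
  move=> /forallP px; rewrite qE => /psumr_eq0P h s; rewrite inE => qs.
  have /eqP := h (fun s _ => mulr_ge0 (px s) (Hw s)) s isT.
  by rewrite mulf_eq0 (negPf qs) orbF => /eqP.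
have supp x : is_root x -> q x = 0 -> supported J x.
  move=> rx qx; have [/suppP|nx] := boolP (pos x); first exact.
  have := suppP (- x); rewrite root_pos_opp // qN qx oppr0.
  move=> /(_ nx erefl) h s /h; rewrite ffunE => /eqP.
  by rewrite oppr_eq0 => /eqP.
exists w^-1%g, J, (map (act w^-1%g) (E ++ map -%R E)); split.
- by apply: supp; [exact: root_act | rewrite /q actVK].
- by apply: supp; [exact: root_act | rewrite /q actVK].
move=> x rx sx; rewrite -[x](actK w) map_f // mem_cat.
have pwx : p (act w x) = 0.
  rewrite -/(q x) qE big1 // => s _; have := sx s; rewrite inE.
  by case: eqP => [->|_ ->]; rewrite ?mulr0 ?mul0r.
have rwx := root_act w rx.
have [wx|wx] := boolP (pos (act w x)); first by rewrite HE ?pwx.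
apply/orP; right; rewrite -[act w x]opprK map_f //.
by apply: HE; rewrite ?pN ?pwx ?oppr0 ?root_pos_opp //; exact: root_opp.
Qed.

(** There are finitely many sets [J] and the form is invariant, so one list per [J] suffices, taken
    empty when the subsystem is infinite. *)
Lemma crossing_values_finite : exists F : seq R, forall b c,
  is_root b -> is_root c -> crossing b c -> bform m b c \in F.
Proof.
have /choice[F HF] (J : {set S}) : exists F : seq R,
    (exists E : seq V, forall x, is_root x -> supported J x -> x \in E) ->
    forall x y, is_root x -> is_root y -> supported J x -> supported J y ->
    bform m x y \in F.
  have [[E HE]|nE] := pselect (exists E : seq V,
      forall x, is_root x -> supported J x -> x \in E); last by exists [::].
  exists [seq bform m x y | x <- E, y <- E] => _ x y rx ry sx sy.
  by apply: allpairs_f; exact: HE.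
exists (flatten [seq F J | J <- enum {set S}]) => b c rb rc cr.
have [w [J [E [sb sc HE]]]] := crossing_finite_parabolic rb rc cr.
apply/flatten_mapP; exists J; first by rewrite mem_enum.
rewrite -(act_isom w); apply: HF => //; try exact: root_act.
by exists E.
Qed.

Lemma crossing_family_bound : exists N : nat, forall M : seq V,
  (forall b, b \in M -> is_root b) -> crossing_family M -> (size M <= N)%N.
Proof.
have [F HF] := crossing_values_finite.
(* The added value [1] is the diagonal of the Gram matrix. *)
exists ((size (1%R :: F)).+1 ^ #|{: S}|)%N => M rM [uM cM].
pose b (i : 'I_(size M)) := nth 0 M i.
have bM i : b i \in M by rewrite mem_nth.
(* The Gram matrix is [X *m Y], so its rank is at most the number of simple roots. *)
pose X := \matrix_(i < size M, j < #|{: S}|) b i (enum_val j).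
pose Y := \matrix_(i < #|{: S}|, j < size M) bform m (alpha (enum_val i)) (b j).
have bI i j : b i = b j -> i = j.
  by move/eqP; rewrite nth_uniq // => /eqP /val_inj.
apply: (gram_size_bound (G := \matrix_(i, j) bform m (b i) (b j))).
- by apply/matrixP => i j; rewrite !mxE bformC.
- apply: leq_trans (mulmx_max_rank X Y); apply: eq_leq; congr (\rank _).
  apply/matrixP => i j; rewrite !mxE {1}[b i]simple_expansion.
  rewrite (big_morph (fun x => bform m x (b j)) (id1 := 0) (op1 := +%R)).
  + rewrite (reindex _ (onW_bij _ (enum_val_bij _))) /=.
    by apply: eq_bigr => k _; rewrite !mxE bformZl.
  + by move=> x y; rewrite bformDl.
  + by rewrite -(scale0r 0) bformZl mul0r.
- move=> i j; rewrite mxE; split=> [|->]; last exact/root_norm/rM.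
  move=> e; apply: contrapT => ij.
  have /eqP := crossing_bform_neq1 (rM _ (bM i)) (rM _ (bM j))
    (cM _ _ (bM i) (bM j) (contra_not (@bI i j) ij)).
  exact.
- move=> i j; rewrite mxE inE.
  have [->|ij] := eqVneq i j; first by rewrite root_norm ?eqxx //; exact: rM.
  rewrite HF ?orbT //; try exact: rM.
  by apply: cM => // /bI /eqP; rewrite (negPf ij).
Qed.

(** * Products of basis elements *)

Section HeckeProduct.
Variables (L : W -> nat) (H : algType laurent) (T : W -> H).
Hypotheses (heckeT : hecke_algebra S L T).
Variable Lmax : nat.
Hypothesis L_le : forall s, (L (val s) <= Lmax)%N.

Lemma length_gen s : ell (val s) = 1%N.
Proof.
have := length_mul_gen mP presW 1%g s; rewrite mul1g length1.
by case.
Qed.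

Lemma hecke_mul_gen w s : ell (w * val s)%g = (ell w).+1 ->
  T w * T (val s) = T (w * val s)%g.
Proof. by move=> ws; rewrite (hecke_mul heckeT) // ws length_gen addn1. Qed.

(** Induction on [ell u] along a left descent. Bounding crossing families lets the hypothesis count
    the folds: each fold lowers [n] by one. *)
Lemma hecke_product_degree n w u :
  (forall M, crossing_family M ->
     (forall b, b \in M -> backtracks w u^-1%g b) -> (size M <= n)%N) ->
  combination_degree_le T (n * Lmax) (T w * T u).
Proof.
have [k] := ubnP (ell u); elim: k n w u => // k IHk n w u uk bound.
have [u1|/(left_descent mP presW)[s su]] := eqVneq u 1%g.
  rewrite (hecke_mul heckeT) ?u1 ?mulg1 ?length1 ?addn0 //.
  exact: combination_basis.
set u' := (val s * u)%g in su.
have uE : u = (val s * u')%g by rewrite /u' (gen_mulgK mP presW).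
have uV : (u^-1 = u'^-1 * val s)%g by rewrite uE invgM (genV mP presW).
have pu' : pos (act u'^-1%g (alpha s)).
  by apply: pos_act_simple; rewrite -uV !(length_inv mP presW).
have -> : T u = T (val s) * T u'.
  by rewrite (hecke_mul heckeT) -?uE // length_gen su.
have step : combination_degree_le T (n * Lmax) (T (w * val s)%g * T u').
  apply: IHk => [|M crM btM]; first lia.
  have [M' [<- crM' btM']] := crossing_family_step btM pu' crM.
  by apply: bound => //; rewrite uV.
rewrite mulrA; have [ws|ws] := length_mul_gen mP presW w s.
  by rewrite hecke_mul_gen.
have wE : T w = T (w * val s)%g * T (val s).
  by rewrite hecke_mul_gen (mulg_genK mP presW).
have nw : ~~ pos (act w (alpha s)).
  by rewrite -root_pos_opp ?neg_act_simple //; exact/root_act/root_simple.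
have fold M := crossing_family_fold nw pu' (M := M).
(* Folding the empty family gives a family of size one, so [n.-1] is a true predecessor. *)
have n0 : (0 < n)%N.
  have [//|//|M' [sM' cM' bM']] := fold [::].
  by have := bound _ cM'; rewrite uV sM'; exact.
(* The quadratic relation is applied to the two last factors of [T (w s) * T s * T s]. *)
have -> : T w * T (val s) * T u' =
    (vvar ^+ L (val s) - vinv ^+ L (val s)) *: (T w * T u') +
    T (w * val s)%g * T u'.
  rewrite {1}wE -[_ * T (val s) * T (val s)]mulrA (hecke_quad heckeT) mulrDr.
  rewrite -scalerAr -wE (hecke_mul heckeT) ?mulg1 ?length1 ?addn0 //.
  by rewrite mulrDl -scalerAl.
apply: combination_add step; apply: (@combination_quad _ _ _ (n.-1 * Lmax)).
  by rewrite -{2}(prednK n0) mulSn addnC leq_add2r.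
apply: IHk => [|M crM btM]; first lia.
(* A family for [w] and [u'] gains a member at the fold, so its size is at most [n - 1]. *)
have [M' [sM' cM' bM']] := fold M crM btM.
by rewrite -ltnS prednK // -sM'; apply: bound => //; rewrite uV.
Qed.

End HeckeProduct.

(** * The uniform bound *)

Lemma exists_bound (L : W -> nat) : exists N, is_bound S L N.
Proof.
have [K HK] := crossing_family_bound.
pose Lmax := (\max_(s : S) L (val s))%N.
(* At most [K] folds occur, each raising the degree by at most [Lmax]. *)
exists (K * Lmax)%N => H T f heckeT fE x y z.
have [|c cE cd] := @combination_lincomb W H T (K * Lmax) (T x * T y).
  apply: (@hecke_product_degree L) => // [s|M crM btM]; first exact: leq_bigmax.
  by apply: HK => // b /btM[].
have [c' [_ uniq_c]] := hecke_basis heckeT (T x * T y).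
have -> : f x y = c by rewrite -(uniq_c _ (fE x y)) (uniq_c _ cE).
exact: cd.
Qed.

End CoxeterRoots.

Theorem theorem1p3 (W : groupType) (S : {fset W}) (L : W -> nat)
    (HWSL : positively_weighted_coxeter S L) :
  exists N : nat, is_bound S L N.
Proof.
have [[m mP presW] _] := HWSL; have [_ _ univ] := presW.
pose R := (Rdefinitions.R : realType).
have m_sym s t := (mP s t).1; have m_diag s t := (mP s t).2.
(* Sending each generator to its simple reflection yields the geometric representation [g]. *)
have [g [gM gs]] := univ _ _ (simple_reflection_braid R m_sym m_diag).
have g1 : g 1%g = 1%g by apply: (mulgI (g 1%g)); rewrite -gM !mulg1.
apply: (exists_bound mP presW (act := fun w => g w)) => [x|w w' x|s x].
- by rewrite g1.
- by rewrite gM.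
- by rewrite gs.
Qed.
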